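(* Let $X$ and $Y$ be Banach spaces. (i) If both $X$ and $Y$ are octahedral, then the injective tensor product $X\widehat{\otimes}_\varepsilon Y$ is octahedral. (ii) If $X$ is octahedral and there exists $y\in S_Y$ such that $n(Y,y)=1$, then $X\widehat{\otimes}_\varepsilon Y$ is octahedral.
   Context: All Banach spaces are real and non-zero. $B_X$ and $S_X$ denote the closed unit ball and the unit sphere of $X$. The injective tensor product $X\widehat{\otimes}_\varepsilon Y$ is the completion of $X\otimes Y$ under the norm $\|u\|:=\sup\{|\sum_{i=1}^n x^*(x_i)y^*(y_i)| : x^*\in S_{X^*},\ y^*\in S_{Y^*}\}$, where $u=\sum_{i=1}^n x_i\otimes y_i$. A Banach space $X$ is octahedral (OH) if for every $x_1,\ldots,x_n\in S_X$ and $\varepsilon>0$ there exists $y\in S_X$ such that $\|x_i+y\|>2-\varepsilon$ for all $i\in\{1,\ldots,n\}$. For a Banach space $X$ and $u\in S_X$, put $D(X,u):=\{f\in B_{X^*}: f(u)=1\}$, and let $n(X,u)$ be the largest non-negative real number $k$ satisfying $k\|x\|\le \sup\{|f(x)|: f\in D(X,u)\}$ for all $x\in X$. *)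

(* Defs.v *)
From HB Require Import structures.
From mathcomp Require Import all_boot all_order all_algebra.
From mathcomp Require Import sesquilinear.
From mathcomp Require Import all_classical all_reals all_analysis.

Set Implicit Arguments.
Unset Strict Implicit.
Unset Printing Implicit Defensive.

Import Order.TTheory GRing.Theory Num.Theory.
Import numFieldNormedType.Exports.

Local Open Scope classical_set_scope.
Local Open Scope ring_scope.

Section Definitions.
Context {R : realType}.

(* The dual X^* consists of the f : {linear X -> R^o} with continuous f. *)
Definition dual_norm {X : normedModType R} (f : {linear X -> R^o}) : R :=
  sup [set `|f x| | x in [set x : X | `|x| <= 1]].

Definition dual_ball (X : normedModType R) : set {linear X -> R^o} :=
  [set f : {linear X -> R^o} | continuous f /\ dual_norm f <= 1].

Definition dual_sphere (X : normedModType R) : set {linear X -> R^o} :=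
  [set f : {linear X -> R^o} | continuous f /\ dual_norm f = 1].

Definition octahedral (X : normedModType R) : Prop :=
  forall (n : nat) (x : 'I_n -> X) (e : R),
    (forall i, `|x i| = 1) -> 0 < e ->
    exists y : X, `|y| = 1 /\ forall i, 2 - e < `|x i + y|.

Definition support_set {X : normedModType R} (u : X) : set {linear X -> R^o} :=
  [set f : {linear X -> R^o} | dual_ball f /\ f u = 1].

Definition index_lower_bounds {X : normedModType R} (u : X) : set R :=
  [set k | 0 <= k /\
     forall x : X, k * `|x| <= sup [set `|f x| | f in support_set u]].

(* This supremum is a maximum: see numerical_indexP below. *)
Definition numerical_index {X : normedModType R} (u : X) : R :=
  sup (index_lower_bounds u).

(* A finite sequence s of pairs (x_i, y_i) stands for the tensor
   sum_i x_i (x) y_i. *)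
Definition injective_norm {X Y : normedModType R} (s : seq (X * Y)) : R :=
  sup [set `|\sum_(p <- s) (fg.1 p.1 * fg.2 p.2 : R)|
      | fg in @dual_sphere X `*` @dual_sphere Y].

(* Z, together with (x, y) |-> t x y, is a completion of the algebraic tensor
   product under the injective norm.  Since the injective norm of a nonzero
   tensor is nonzero, the first condition makes x (x) y |-> t x y an isometric
   linear embedding of the algebraic tensor product into Z.  Such a Z exists
   (injective_tensor_product_exists below), and is unique up to a linear
   isometry compatible with t. *)
Definition is_injective_tensor_product {X Y : normedModType R}
    (Z : completeNormedModType R) (t : {bilinear X -> Y -> Z}) : Prop :=
  (forall s : seq (X * Y),
     `|\sum_(p <- s) t p.1 p.2| = injective_norm s) /\
  dense [set z : Z | exists s : seq (X * Y), z = \sum_(p <- s) t p.1 p.2].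

End Definitions.

Section NumericalIndex.
Context {R : realType} {X : normedModType R}.

Lemma sup_norm_ge0 (T : Type) (A : set T) (f : T -> R) :
  0 <= sup [set `|f a| | a in A].
Proof.
have [[[_ [a Aa _]] bA]|/sup_out -> //] := pselect (has_sup [set `|f a| | a in A]).
apply: (le_trans (normr_ge0 (f a))); apply: ub_le_sup => //.
by exists a.
Qed.

Lemma numerical_indexP (u : X) : (exists x : X, x != 0) ->
  index_lower_bounds u (numerical_index u) /\
  ubound (index_lower_bounds u) (numerical_index u).
Proof.
move=> [x0 x0N0].
have ub : has_ubound (index_lower_bounds u).
  exists (sup [set `|f x0| | f in support_set u] / `|x0|) => k [_ /(_ x0)].
  by rewrite ler_pdivlMr ?normr_gt0.
have mem0 : index_lower_bounds u 0.
  by split=> // x; rewrite mul0r; exact: sup_norm_ge0.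
split; last exact: ub_le_sup.
split; first exact: ub_le_sup.
move=> x; have [->|xN0] := eqVneq x 0.
  by rewrite normr0 mulr0; exact: sup_norm_ge0.
rewrite -ler_pdivlMr ?normr_gt0//; apply: ge_sup; first by exists 0.
by move=> k [_ /(_ x)]; rewrite ler_pdivlMr ?normr_gt0.
Qed.

End NumericalIndex.

(* Existence: the functions on the product of the dual spheres which are
   uniform limits of tensors, with the sup norm. *)
Section Existence.
Context {R : realType} (X Y : normedModType R).

Definition sphere_pair : Type :=
  {fg : {linear X -> R^o} * {linear Y -> R^o}
  | dual_sphere fg.1 /\ dual_sphere fg.2}.

Definition tensor_fun (s : seq (X * Y)) : sphere_pair -> R^o :=
  fun fg => \sum_(p <- s) ((sval fg).1 p.1 * (sval fg).2 p.2 : R).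

Definition tensor_limit : {pred sphere_pair -> R^o} := fun F =>
  `[< forall e : R, 0 < e ->
        exists s, forall fg, `|F fg - tensor_fun s fg| <= e >].

Lemma tensor_limitP (F : sphere_pair -> R^o) :
  reflect (forall e : R, 0 < e ->
            exists s, forall fg, `|F fg - tensor_fun s fg| <= e)
          (F \in tensor_limit).
Proof. exact: asboolP. Qed.

Lemma tensor_fun_cat s1 s2 fg :
  tensor_fun (s1 ++ s2) fg = tensor_fun s1 fg + tensor_fun s2 fg.
Proof. by rewrite /tensor_fun big_cat. Qed.

Lemma tensor_fun_scale (a : R) s fg :
  tensor_fun [seq (a *: p.1, p.2) | p <- s] fg = a * tensor_fun s fg.
Proof.
rewrite /tensor_fun big_map mulr_sumr; apply: eq_bigr => p _ /=.
by rewrite linearZ -mulrA.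
Qed.

Lemma tensor_limit_submod : submod_closed tensor_limit.
Proof.
split.
  apply/tensor_limitP => e e0; exists [::] => fg.
  by rewrite /tensor_fun big_nil subr0 normr0 ltW.
move=> a F G /tensor_limitP FL /tensor_limitP GL.
apply/tensor_limitP => e e0.
have a0 : 0 < `|a| + 1 by rewrite ltr_wpDl.
have [s1 s1P] := FL (e / 2 / (`|a| + 1)) ltac:(by rewrite !divr_gt0).
have [s2 s2P] := GL (e / 2) ltac:(by rewrite divr_gt0).
exists ([seq (a *: p.1, p.2) | p <- s1] ++ s2) => fg.
rewrite tensor_fun_cat tensor_fun_scale.
have -> : (a *: F + G) fg = a * F fg + G fg by [].
rewrite opprD addrACA -mulrBr (splitr e) (le_trans (ler_normD _ _))// lerD//.
rewrite normrM (@le_trans _ _ ((`|a| + 1) * (e / 2 / (`|a| + 1))))//.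
  by apply: ler_pM => //; rewrite lerDl.
by rewrite mulrC divfK// gt_eqF.
Qed.

HB.instance Definition _ :=
  GRing.isSubmodClosed.Build R (sphere_pair -> R^o) tensor_limit
    tensor_limit_submod.

Record tensor_model := TensorModel {
  tensor_model_val :> sphere_pair -> R^o;
  _ : tensor_model_val \in tensor_limit }.

HB.instance Definition _ := [isSub for tensor_model_val].
HB.instance Definition _ := [Choice of tensor_model by <:].
HB.instance Definition _ := [SubChoice_isSubLmodule of tensor_model by <:].

Implicit Types F G : tensor_model.

Lemma dual_sphere_le (V : normedModType R) (f : {linear V -> R^o}) (x : V) :
  dual_sphere f -> `|f x| <= `|x|.
Proof.
move=> [cf f1]; have [->|xN0] := eqVneq x 0; first by rewrite linear0 !normr0.
have hs : has_sup [set `|f x| | x in [set x : V | `|x| <= 1]].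
  apply: contrapT => /sup_out s0.
  by move: f1; rewrite /dual_norm s0 => /eqP; rewrite eq_sym oner_eq0.
have x0 : 0 < `|x| by rewrite normr_gt0.
have : `|f (`|x|^-1 *: x)| <= 1.
  rewrite -f1; apply: ub_le_sup; first by case: hs.
  by exists (`|x|^-1 *: x) => //=; rewrite normrZ normfV normr_id mulVf ?gt_eqF.
by rewrite linearZ normrZ normfV normr_id ler_pdivrMl// mulr1.
Qed.

Lemma tensor_fun_bounded s : exists M, forall fg, `|tensor_fun s fg| <= M.
Proof.
exists (\sum_(p <- s) `|p.1| * `|p.2|) => -[[f g] [/= df dg]].
rewrite (le_trans (ler_norm_sum _ _ _))//; apply: ler_sum => p _ /=.
by rewrite normrM ler_pM// dual_sphere_le.
Qed.

Lemma tensor_model_bounded F : exists M, forall fg, `|F fg| <= M.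
Proof.
have [s sP] := elimT (tensor_limitP _) (valP F) 1 ltr01.
have [M MP] := tensor_fun_bounded s.
exists (1 + M) => fg.
by rewrite -[F fg](subrK (tensor_fun s fg)) (le_trans (ler_normD _ _))// lerD.
Qed.

Definition model_norm F : R := sup (range (fun fg => `|F fg|)).

Lemma model_norm_ge F fg : `|F fg| <= model_norm F.
Proof.
apply: ub_le_sup; last by exists fg.
by have [M MP] := tensor_model_bounded F; exists M => _ [h _ <-].
Qed.

Lemma model_norm_le F (M : R) :
  0 <= M -> (forall fg, `|F fg| <= M) -> model_norm F <= M.
Proof.
move=> M0 FM.
have [ne|ne] := pselect (range (fun fg => `|F fg|) !=set0).
  by apply: ge_sup => // _ [fg _ <-].
by rewrite /model_norm sup_out// => -[].
Qed.

Lemma model_norm_ge0 F : 0 <= model_norm F.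
Proof. exact: sup_norm_ge0. Qed.

Lemma model_normD F G : model_norm (F + G) <= model_norm F + model_norm G.
Proof.
apply: model_norm_le => [|fg]; first by rewrite addr_ge0 ?model_norm_ge0.
by rewrite (le_trans (ler_normD _ _))// lerD// model_norm_ge.
Qed.

Lemma model_normZ (a : R) F : model_norm (a *: F) = `|a| * model_norm F.
Proof.
have le b G : model_norm (b *: G) <= `|b| * model_norm G.
  apply: model_norm_le => [|fg]; first by rewrite mulr_ge0 ?model_norm_ge0.
  have -> : (b *: G : tensor_model) fg = b * G fg by [].
  by rewrite normrM ler_wpM2l// model_norm_ge.
apply/eqP; rewrite eq_le le/=.
have [->|aN0] := eqVneq a 0; first by rewrite normr0 mul0r model_norm_ge0.
rewrite -ler_pdivlMl ?normr_gt0// -normfV.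
by apply: le_trans (le _ _); rewrite scalerA mulVf// scale1r.
Qed.

Lemma model_norm_eq0 F : model_norm F = 0 -> F = 0.
Proof.
move=> F0; apply: val_inj; apply/funext => fg; apply/eqP.
by rewrite -normr_le0 -F0 model_norm_ge.
Qed.

HB.instance Definition _ := Lmodule_isNormed.Build R tensor_model
  model_normD model_normZ model_norm_eq0.

Lemma tensor_model_complete (A : set_system tensor_model) :
  ProperFilter A -> cauchy A -> cvg A.
Proof.
move=> PA /cauchy_ballP Ac.
have Acn (e : R) : 0 < e -> \forall F & G \near A, `|F - G| < e.
  move=> e0; have := Ac e e0; apply: filterS => -[F G] /=.
  by rewrite -ball_normE.
have lim_ex fg : exists l : R^o, (F : tensor_model) fg @[F --> A] --> l.
  suff : cvg ((fun F : tensor_model => F fg : R^o) @ A) by move/cvg_ex.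
  apply/cauchy_cvgP/cauchy_exP => e e0.
  have [F FA] := @filter_ex _ _ PA _ (nearP_dep (Acn _ e0)).
  exists (F fg); apply: filterS FA => G FG; rewrite -ball_normE /=.
  by apply: le_lt_trans FG; exact: (model_norm_ge (F - G)).
pose L : sphere_pair -> R^o := fun fg => sval (cid (lim_ex fg)).
have LP fg : (F : tensor_model) fg @[F --> A] --> L fg.
  exact: svalP (cid (lim_ex fg)).
have AL (e : R) : 0 < e ->
    \forall F \near A, forall fg, `|L fg - (F : tensor_model) fg| <= e.
  move=> e0; have e20 : 0 < e / 2 by rewrite divr_gt0.
  have := Acn _ e20 => /nearP_dep; apply: filterS => F FG fg.
  near A => G.
  rewrite -(subrK (G fg) (L fg)) -addrA (splitr e).
  rewrite (le_trans (ler_normD _ _))// lerD//.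
    near: G; have /cvgrPdist_le := LP fg; exact.
  rewrite distrC (le_trans (model_norm_ge (F - G) fg))// ltW//.
  by near: G.
have Llim : L \in tensor_limit.
  apply/tensor_limitP => e e0; have e20 : 0 < e / 2 by rewrite divr_gt0.
  have [F FL] := @filter_ex _ _ PA _ (AL _ e20).
  have [s sF] := elimT (tensor_limitP _) (valP F) _ e20.
  exists s => fg; rewrite -(subrK (F fg) (L fg)) -addrA (splitr e).
  by rewrite (le_trans (ler_normD _ _))// lerD//; exact: sF.
apply/cvg_ex; exists (TensorModel Llim); apply/cvgrPdist_le => e e0.
have := AL _ e0; apply: filterS => F FL.
exact: (@model_norm_le (TensorModel Llim - F) e (ltW e0)).
Unshelve. all: by end_near. Qed.

HB.instance Definition _ :=
  Uniform_isComplete.Build tensor_model tensor_model_complete.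

Lemma tensor_fun_limit s : tensor_fun s \in tensor_limit.
Proof.
by apply/tensor_limitP => e e0; exists s => fg; rewrite subrr normr0 ltW.
Qed.

Definition model_tensor (x : X) (y : Y) : tensor_model :=
  TensorModel (tensor_fun_limit [:: (x, y)]).

Lemma model_tensor_bilinear : bilinear_for *:%R *:%R model_tensor.
Proof.
split=> [y|x] a u v; apply: val_inj; apply/funext => fg.
- transitivity (a * tensor_fun [:: (u, y)] fg + tensor_fun [:: (v, y)] fg) => //.
  rewrite -[LHS]/(tensor_fun [:: (a *: u + v, y)] fg) /tensor_fun !big_seq1 /=.
  by rewrite linearP mulrDl mulrA.
- transitivity (a * tensor_fun [:: (x, u)] fg + tensor_fun [:: (x, v)] fg) => //.
  rewrite -[LHS]/(tensor_fun [:: (x, a *: u + v)] fg) /tensor_fun !big_seq1 /=.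
  by rewrite linearP mulrDr mulrCA.
Qed.

HB.instance Definition _ := bilinear_isBilinear.Build R X Y tensor_model
  *:%R *:%R model_tensor model_tensor_bilinear.

Lemma model_tensor_sumE (s : seq (X * Y)) fg :
  (\sum_(p <- s) model_tensor p.1 p.2 : tensor_model) fg = tensor_fun s fg.
Proof.
elim: s => [|p s IH]; first by rewrite big_nil /tensor_fun big_nil.
have E : model_tensor p.1 p.2 fg = (sval fg).1 p.1 * (sval fg).2 p.2.
  exact: big_seq1.
rewrite big_cons [RHS]big_cons -/(tensor_fun s fg) -IH -E; reflexivity.
Qed.

Lemma model_tensor_norm (s : seq (X * Y)) :
  `|\sum_(p <- s) model_tensor p.1 p.2| = injective_norm s.
Proof.
rewrite -[LHS]/(model_norm _); congr sup; apply/seteqP; split=> r.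
  by move=> [[[f g] fgS] _ <-]; exists (f, g) => //; rewrite model_tensor_sumE.
move=> [[f g] fgS <-]; exists (exist _ (f, g) fgS) => //.
by rewrite model_tensor_sumE.
Qed.

Lemma model_tensor_dense : dense [set z : tensor_model |
  exists s : seq (X * Y), z = \sum_(p <- s) model_tensor p.1 p.2].
Proof.
move=> O [F OF] oO.
have [e /= e0 eO] : exists2 e : R, 0 < e & ball F e `<=` O.
  by apply/nbhs_ballP; exact: open_nbhs_nbhs.
have e20 : 0 < e / 2 by rewrite divr_gt0.
have [s sF] := elimT (tensor_limitP _) (valP F) _ e20.
exists (\sum_(p <- s) model_tensor p.1 p.2); split; last by exists s.
apply: eO; rewrite -ball_normE /=.
apply: (@le_lt_trans _ _ (e / 2)); last by rewrite ltr_pdivrMr// ltr_pMr// ltr1n.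
apply: model_norm_le; first exact: ltW.
move=> fg; have := sF fg; rewrite -model_tensor_sumE; exact.
Qed.

End Existence.

Lemma injective_tensor_product_exists (R : realType) (X Y : normedModType R) :
  exists (Z : completeNormedModType R) (t : {bilinear X -> Y -> Z}),
    is_injective_tensor_product t.
Proof.
exists (tensor_model X Y), (@model_tensor R X Y).
by split; [exact: model_tensor_norm|exact: model_tensor_dense].
Qed.

(* Main.v *)
(* Approximate the given unit vectors of Z by tensors u_i, and almost norm each
   u_i by some f0_i (x) g0_i.  The vectors v_i = (f0_i (x) id) u_i are almost
   normed, up to sign, by functionals g_i that are almost 1 at a common y in
   S_Y, because Y is octahedral or n(Y, y) = 1.  Then w_i = (id (x) g_i) u_i has
   norm almost 1, so octahedrality of X gives f_i almost norming w_i and almost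
   1 at a common x in S_X.  Evaluating u_i + x (x) y at f_i (x) g_i gives almost
   2.  Only finitely many functionals occur, so no net in a finite-dimensional
   subspace is needed. *)
Require Import Defs.
From HB Require Import structures.
From mathcomp Require Import all_boot all_order all_algebra.
From mathcomp Require Import sesquilinear.
From mathcomp Require Import all_classical all_reals all_analysis.
From mathcomp Require Import lra.
Set Implicit Arguments.
Unset Strict Implicit.
Unset Printing Implicit Defensive.
Import Order.TTheory GRing.Theory Num.Theory.
Import numFieldNormedType.Exports.
Local Open Scope classical_set_scope.
Local Open Scope ring_scope.

(** * Hahn-Banach theorem via minimal sublinear functionals *)

Section HahnBanach.
Context {R : realType} {V : lmodType R}.
Implicit Types (p : V -> R) (x y : V).

(** Homogeneity is stated as an inequality, which is easier to check for infima; applying it to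
    [a^-1] as well gives equality. *)
Definition sublinear p :=
  (forall x y, p (x + y) <= p x + p y) /\
  (forall a x, 0 < a -> p (a *: x) <= a * p x).

Lemma sublinear0 p : sublinear p -> p 0 = 0.
Proof.
move=> [_ pZ]; have h2 : (0 : R) < 2 by [].
have := pZ 2 0 h2; have := pZ 2^-1 0; rewrite invr_gt0 !scaler0 => /(_ h2).
by move=> h h'; apply/eqP; rewrite eq_le; apply/andP; split; lra.
Qed.

Lemma sublinearZ p a x : sublinear p -> 0 <= a -> p (a *: x) = a * p x.
Proof.
move=> sp; rewrite le_eqVlt => /predU1P[<-|a0].
  by rewrite scale0r mul0r sublinear0.
have [_ pZ] := sp; apply/eqP; rewrite eq_le pZ//= -ler_pdivlMl//.
by rewrite -{1}[x](scalerK (lt0r_neq0 a0)) pZ// invr_gt0.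
Qed.

Lemma sublinear_ge p x : sublinear p -> - p (- x) <= p x.
Proof.
move=> sp; have [pD _] := sp; have := pD x (- x).
by rewrite subrr sublinear0// => ?; lra.
Qed.

(** For sublinear [p] this is the largest sublinear [q <= p] with [q (- x) <= - p x]. A linear
    functional below it therefore takes the value [p x] at [x]. *)
Definition directional_inf p x y : R :=
  inf [set p (y + t *: x) - t * p x | t in [set t : R | 0 <= t]].

Section DirectionalInf.
Context (p : V -> R) (x : V) (sp : sublinear p).

Lemma directional_inf_le y t : 0 <= t ->
  directional_inf p x y <= p (y + t *: x) - t * p x.
Proof.
move=> t0; apply: ge_inf; last by exists t.
(* The lower bound comes from [p (s *: x) <= p (y + s *: x) + p (- y)]. *)
exists (- p (- y)) => _ [s s0 <-]; have [pD _] := sp.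
have := pD (y + s *: x) (- y).
by rewrite addrAC subrr add0r sublinearZ// => ?; lra.
Qed.

Lemma directional_inf_ge y c :
  (forall t, 0 <= t -> c <= p (y + t *: x) - t * p x) ->
  c <= directional_inf p x y.
Proof.
move=> H; apply: lb_le_inf; first by (eexists; exists 0 => //=; exact: lexx).
by move=> _ [t t0 <-]; exact: H.
Qed.

Lemma sublinear_directional_inf : sublinear (directional_inf p x).
Proof.
split=> [y z|a y a0].
  rewrite -lerBlDr; apply: directional_inf_ge => s s0.
  rewrite lerBlDr -lerBlDl; apply: directional_inf_ge => t t0.
  (* The parameters [s] for [y] and [t] for [z] combine to [s + t] for [y + z]. *)
  rewrite lerBlDl; apply: le_trans (directional_inf_le _ (addr_ge0 s0 t0)) _.
  have [pD _] := sp; have := pD (y + s *: x) (z + t *: x).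
  by rewrite addrACA -scalerDl => ?; lra.
rewrite -ler_pdivrMl//; apply: directional_inf_ge => t t0.
rewrite ler_pdivrMl//.
apply: le_trans (directional_inf_le _ (mulr_ge0 (ltW a0) t0)) _.
by rewrite -scalerA -scalerDr (sublinearZ _ sp) ?(ltW a0)// mulrBr mulrA.
Qed.

End DirectionalInf.

(* A minimal sublinear functional p satisfies p <= directional_inf p x for
   every x, which makes it additive. *)
Theorem sublinear_ge_linear p : sublinear p ->
  exists f : {linear V -> R^o}, forall x, f x <= p x.
Proof.
move=> sp.
pose T := {q : V -> R | sublinear q /\ forall x, q x <= p x}.
(* The order is reversed, so that Zorn's lemma yields a minimal functional. *)
pose below (q r : T) := `[< forall x, sval r x <= sval q x >].
have t0 : T by exists p.
have [||A totA|[q [sq qp]] qmin] := @ZL_preorder T t0 below.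
- by move=> q; apply/asboolP.
- move=> q r s /asboolP qr /asboolP rs; apply/asboolP => x.
  exact: le_trans (rs x) (qr x).
- have [[q0 Aq0]|A0] := pselect (A !=set0); last first.
    by exists t0 => q Aq; exfalso; apply: A0; exists q.
  pose m x := inf [set sval q x | q in A].
  have mle q x : A q -> m x <= sval q x.
    move=> Aq; apply: ge_inf; last by exists q.
    exists (- p (- x)) => _ [[r [sr rp]] _ <-] /=.
    by apply: le_trans (sublinear_ge _ sr); rewrite lerN2.
  have mge x c : (forall q, A q -> c <= sval q x) -> c <= m x.
    move=> H; apply: lb_le_inf; first by (eexists; exists q0).
    by move=> _ [q Aq <-]; exact: H.
  have sm : sublinear m.
    split=> [x y|a x a0].
      rewrite -lerBlDr; apply: (mge) => q Aq; rewrite lerBlDr -lerBlDl.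
      apply: (mge) => r Ar; rewrite lerBlDl.
      (* Members of a chain are comparable; the smaller of [q] and [r] bounds [m (x + y)]. *)
      have [/asboolP rq|/asboolP qr] := totA q r Aq Ar.
        apply: le_trans (mle r _ Ar) _; have [[rD _] _] := svalP r.
        by apply: le_trans (rD x y) _; rewrite lerD2r.
      apply: le_trans (mle q _ Aq) _; have [[qD _] _] := svalP q.
      by apply: le_trans (qD x y) _; rewrite lerD2l.
    rewrite -ler_pdivrMl//; apply: (mge) => q Aq; rewrite ler_pdivrMl//.
    by apply: le_trans (mle q _ Aq) _; have [[_ qZ] _] := svalP q; exact: qZ.
  have mp x : m x <= p x.
    by apply: le_trans (mle q0 _ Aq0) _; have [_] := svalP q0; exact.
  by exists (exist _ m (conj sm mp)) => q Aq; apply/asboolP => x; exact: mle.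
have qD x y : q (x + y) = q x + q y.
  have dq z : directional_inf q x z <= q z.
    by have := directional_inf_le x sq z (lexx 0); rewrite scale0r mul0r addr0 subr0.
  have dp z : directional_inf q x z <= p z.
    exact: le_trans (dq z) (qp z).
  have /asboolP /(_ y) /= := qmin
    (exist _ _ (conj (sublinear_directional_inf x sq) dp)) (asboolT dq).
  have := directional_inf_le x sq y ler01.
  rewrite scale1r mul1r (addrC y) => h1 h2; have [qD _] := sq.
  by apply/eqP; rewrite eq_le qD/=; lra.
have qN x : q (- x) = - q x.
  by apply/eqP; rewrite eq_sym -subr_eq0 -opprD oppr_eq0 -qD subrr sublinear0.
have qL : linear (q : V -> R^o).
  move=> a x y; rewrite qD; congr (_ + _).
  have [a0|/ltW a0] := leP 0 a; first exact: sublinearZ.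
  by rewrite -[a]opprK scaleNr qN sublinearZ ?oppr_ge0// scaleNr.
by exists (HB.pack_for {linear V -> R^o} (q : V -> R^o)
  (GRing.isLinear.Build _ _ _ _ _ qL)).
Qed.

End HahnBanach.

(** * Functionals attaining the norm at a given vector *)

Section NormingFunctionals.
Context {R : realType} {V : normedModType R}.
Implicit Types (f g : {linear V -> R^o}) (x y v : V).

Lemma dual_ball_le f x : dual_ball f -> `|f x| <= `|x|.
Proof.
move=> [cf f1]; have [->|x0] := eqVneq x 0; first by rewrite linear0 !normr0.
have nx0 : 0 < `|x| by rewrite normr_gt0.
(* Continuity enters here: the [sup] of an unbounded set is 0 by default, so [dual_norm f <= 1]
   alone bounds nothing. *)
have ub : has_ubound [set `|f y| | y in [set y : V | `|y| <= 1]].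
  have /linear_boundedP/pinfty_ex_gt0[r r0 fr] :=
    continuous_linear_bounded 0 (cf 0).
  exists r => _ [y /= y1 <-]; apply: le_trans (fr y) _.
  by rewrite ler_piMr// ltW.
have : `|f (`|x|^-1 *: x)| <= 1.
  apply: le_trans f1; apply: ub_le_sup => //; exists (`|x|^-1 *: x) => //=.
  by rewrite normrZ normfV normr_id mulVf ?gt_eqF.
by rewrite linearZ normrZ normfV normr_id ler_pdivrMl// mulr1.
Qed.

Lemma norming_dual_sphere f x : (forall y, `|f y| <= `|y|) ->
  x != 0 -> f x = `|x| -> dual_sphere f.
Proof.
move=> fle x0 fx; have nx0 : 0 < `|x| by rewrite normr_gt0.
split.
  apply/bounded_linear_continuous/linear_boundedP; exists 1; split=> // r r1 y.
  by apply: le_trans (fle y) _; rewrite ler_peMl// ltW.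
have fx1 : `|f (`|x|^-1 *: x)| = 1.
  by rewrite linearZ/= fx normrM normfV normr_id mulVf ?gt_eqF.
have ub1 : ubound [set `|f y| | y in [set y : V | `|y| <= 1]] 1.
  by move=> _ [y /= y1 <-]; exact: le_trans (fle y) y1.
have mem1 : [set `|f y| | y in [set y : V | `|y| <= 1]] 1.
  exists (`|x|^-1 *: x) => //=.
  by rewrite normrZ normfV normr_id mulVf ?gt_eqF.
apply/eqP; rewrite eq_le; apply/andP; split.
  by apply: ge_sup => //; exists 1.
by apply: ub_le_sup => //; exists 1.
Qed.

(** A linear [f] below [directional_inf N x] satisfies [f <= N] (parameter 0) and [f (- x) <= - N x]
    (parameter 1). *)
Lemma norming_functional x : x != 0 ->
  exists f, dual_sphere f /\ f x = `|x|.
Proof.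
move=> x0; pose N (y : V) : R := `|y|.
have sN : sublinear N.
  by split=> [y z|a y a0]; [exact: ler_normD|rewrite /N normrZ gtr0_norm].
have [f fle] := sublinear_ge_linear (sublinear_directional_inf x sN).
have fN y : f y <= `|y|.
  apply: le_trans (fle y) _.
  have := directional_inf_le x sN y (lexx 0).
  by rewrite scale0r mul0r addr0 subr0.
have fle1 y : `|f y| <= `|y|.
  by rewrite ler_norml fN andbT lerNl -linearN -(normrN y) fN.
exists f; suff fx : f x = `|x| by split=> //; exact: norming_dual_sphere fx.
apply/eqP; rewrite eq_le fN/= -lerN2 -linearN; apply: le_trans (fle _) _.
have := directional_inf_le x sN (- x) ler01.
by rewrite scale1r mul1r addNr /N normr0 sub0r.
Qed.

End NormingFunctionals.

(** * Common norming directions from octahedrality and from numerical index 1 *)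

Lemma sup_norm_gt {R : realType} {T : Type} (A : set T) (F : T -> R) c :
  0 <= c -> c < sup [set `|F a| | a in A] -> exists2 a, A a & c < `|F a|.
Proof.
move=> c0 cs; have [A0|A0] := pselect ([set `|F a| | a in A] !=set0).
  by have [_ [a Aa <-] ca] := sup_gt A0 cs; exists a.
(* The empty set has [sup] 0 by default, which [0 <= c] excludes. *)
by move: cs; rewrite sup_out ?ltNge ?c0// => -[].
Qed.

(** A functional norming the sum of two unit vectors has value at most 1 on each; if the sum has
    norm above [2 - d], both values exceed [1 - d]. *)
Lemma octahedral_norming {R : realType} {V : normedModType R} (d : R)
    n (v : 'I_n -> V) :
  octahedral V -> 0 < d -> (forall i, v i != 0) ->
  exists y : V, `|y| = 1 /\
  forall i, exists g : {linear V -> R^o},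
    [/\ dual_sphere g, (1 - d) * `|v i| < g (v i) & 1 - d < g y].
Proof.
move=> OV d0 v0.
have vn0 i : 0 < `|v i| by rewrite normr_gt0.
have v1 i : `| `|v i|^-1 *: v i| = 1.
  by rewrite normrZ normfV normr_id mulVf ?gt_eqF.
(* The cap at 1 keeps the sums below nonzero even for large [d]. *)
have m0 : 0 < Num.min d 1 by rewrite lt_min d0 ltr01.
have [y [y1 yv]] := OV n (fun i => `|v i|^-1 *: v i) (Num.min d 1) v1 m0.
exists y; split=> // i.
have vy : 2 - d < `| `|v i|^-1 *: v i + y|.
  by apply: le_lt_trans (yv i); rewrite lerD2l lerN2 ge_min lexx.
have vy0 : `|v i|^-1 *: v i + y != 0.
  rewrite -normr_gt0; apply: le_lt_trans (yv i).
  by rewrite subr_ge0 ge_min ler1n orbT.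
have [g [gS gvy]] := norming_functional vy0.
have := dual_sphere_le y gS; rewrite y1 => /(le_trans (ler_norm _)) gy.
have := dual_sphere_le (`|v i|^-1 *: v i) gS.
rewrite v1 => /(le_trans (ler_norm _)) gv.
move: vy; rewrite -gvy linearD => vy.
exists g; split=> //; last by lra.
rewrite mulrC -ltr_pdivlMl//.
rewrite -[ltRHS]/(_ *: (g (v i) : R^o)) -linearZ; lra.
Qed.

(** Index 1 means that the functionals supporting [y] norm all of [V]. Each has norm exactly 1
    because it is 1 at the unit vector [y]. *)
Lemma numerical_index_norming {R : realType} {V : normedModType R} (d : R)
    (v y : V) :
  `|y| = 1 -> numerical_index y = 1 -> 0 < d -> d <= 1 -> v != 0 ->
  exists g : {linear V -> R^o},
    [/\ dual_sphere g, (1 - d) * `|v| < `|g v| & g y = 1].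
Proof.
move=> y1 ny d0 d1 v0.
have [[_ +] _] := numerical_indexP y (ex_intro _ v v0).
rewrite ny => /(_ v); rewrite mul1r => vle.
have dv : (1 - d) * `|v| < `|v| by rewrite gtr_pMl ?normr_gt0//; lra.
have dv0 : 0 <= (1 - d) * `|v| by rewrite mulr_ge0// subr_ge0.
have [g [gB gy] gv] := sup_norm_gt dv0 (lt_le_trans dv vle).
exists g; split=> //; apply: (@norming_dual_sphere _ _ g y).
- by move=> z; exact: dual_ball_le.
- by rewrite -normr_gt0 y1.
- by rewrite gy y1.
Qed.

(** The absolute value accommodates the numerical index case, where replacing [g] by its negative
    would spoil the value at [y]. *)
Definition norming_direction {R : realType} {V : normedModType R} (d : R)
    n (v : 'I_n -> V) (y : V) :=
  forall i, exists g : {linear V -> R^o},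
    [/\ dual_sphere g, (1 - d) * `|v i| < `|g (v i)| & 1 - d < g y].

(** * Octahedrality of the injective tensor product *)

Section InjectiveTensor.
Context {R : realType} {X Y : normedModType R} {Z : completeNormedModType R}.
Context (t : {bilinear X -> Y -> Z}) (tP : is_injective_tensor_product t).
Implicit Types (f : {linear X -> R^o}) (g : {linear Y -> R^o}).

Lemma injective_norm_ge s f g : dual_sphere f -> dual_sphere g ->
  `|\sum_(p <- s) (f p.1 * g p.2 : R)| <= `|\sum_(p <- s) t p.1 p.2|.
Proof.
move=> fS gS; have [-> _] := tP; apply: ub_le_sup; last by exists (f, g).
have [M MP] := tensor_fun_bounded s; exists M => _ [[f' g'] fgS <-].
exact: (MP (exist _ (f', g') fgS)).
Qed.

Lemma norm_elementary_tensor x y : `|x| = 1 -> `|y| = 1 -> `|t x y| = 1.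
Proof.
move=> x1 y1.
have x0 : x != 0 by rewrite -normr_gt0 x1.
have y0 : y != 0 by rewrite -normr_gt0 y1.
have [f [fS fx]] := norming_functional x0.
have [g [gS gy]] := norming_functional y0.
apply/eqP; rewrite eq_le; apply/andP; split; last first.
  have := injective_norm_ge [:: (x, y)] fS gS.
  by rewrite !big_seq1 /= fx gy x1 y1 mulr1 normr1.
have [/(_ [:: (x, y)])] := tP; rewrite big_seq1 /= => -> _.
apply: ge_sup; first by (eexists; exists (f, g)).
move=> _ [[f' g'] [/= f'S g'S] <-]; rewrite big_seq1 /= normrM.
have := dual_sphere_le x f'S; have := dual_sphere_le y g'S.
by rewrite x1 y1 => ? ?; rewrite mulr_ile1.
Qed.

Lemma tensor_approximation (z : Z) (d : R) : `|z| = 1 -> 0 < d -> d <= 1 ->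
  exists s f g, [/\ `|z - \sum_(p <- s) t p.1 p.2| < d,
    dual_sphere f, dual_sphere g &
    1 - d < `|\sum_(p <- s) (f p.1 * g p.2 : R)|].
Proof.
move=> z1 d0 d1; have [tn td] := tP.
have [u [zu [s us]]] := td (ball z d)
  (ex_intro _ z (ballxx z d0)) (ball_open z _).
rewrite -ball_normE /= us in zu.
have : 1 - d < `|\sum_(p <- s) t p.1 p.2|.
  have := ler_normD (z - \sum_(p <- s) t p.1 p.2) (\sum_(p <- s) t p.1 p.2).
  by rewrite subrK z1; lra.
rewrite tn => /sup_norm_gt[|[f g] [/= fS gS] fg]; first by rewrite subr_ge0.
by exists s, f, g.
Qed.

(** The hypothesis on [Y] isolates what cases (i) and (ii) share: one direction [y] serving a whole
    finite family. *)
Lemma octahedral_tensor : octahedral X ->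
  (forall n (v : 'I_n -> Y) (d : R), 0 < d -> d <= 1 -> (forall i, v i != 0) ->
    exists y : Y, `|y| = 1 /\ norming_direction d v y) ->
  octahedral Z.
Proof.
move=> OX HY n z e z1 e0.
(* The final bound is [(1 - d)^3 + (1 - d)^2 - d], which is at least [2 - 6 * d]. *)
have [d [d0 d1 de]] : exists d : R, [/\ 0 < d, d < 1 & 6 * d <= e].
  exists (Num.min 2^-1 (e / 6)); split.
  - by rewrite lt_min invr_gt0 ltr0n divr_gt0.
  - by rewrite gt_min; apply/orP; left; lra.
  - by rewrite mulrC -ler_pdivlMr// ge_min lexx orbT.
have /choice[s /choice[f0 /choice[g0 sP]]] :=
  fun i => tensor_approximation (z1 i) d0 (ltW d1).
pose v i := \sum_(p <- s i) f0 i p.1 *: p.2.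
have gv i (g : {linear Y -> R^o}) :
    g (v i) = \sum_(p <- s i) (f0 i p.1 * g p.2 : R).
  by rewrite linear_sum; apply: eq_bigr => p _; rewrite linearZ.
have v1 i : 1 - d < `|v i|.
  have [_ _ gS] := sP i; rewrite -gv => /lt_le_trans; apply.
  exact: dual_sphere_le.
have [|y [y1 /choice[g gP]]] := HY n v d d0 (ltW d1).
  by move=> i; rewrite -normr_gt0; apply: le_lt_trans (v1 i); lra.
pose w i := \sum_(p <- s i) g i p.2 *: p.1.
have fw i (f : {linear X -> R^o}) :
    f (w i) = \sum_(p <- s i) (f p.1 * g i p.2 : R).
  by rewrite linear_sum; apply: eq_bigr => p _; rewrite linearZ mulrC.
(* Since [f0 i (w i) = g i (v i)], only the absolute value of the latter matters; its unknown sign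
   disappears in the norm of [w i]. *)
have w1 i : (1 - d) * (1 - d) < `|w i|.
  have [_ f0S _ _] := sP i; have [_ gvi _] := gP i.
  apply: lt_le_trans (dual_sphere_le (w i) f0S); rewrite fw -gv.
  by apply: lt_trans gvi; rewrite ltr_pM2l// subr_gt0.
have [|x [x1 /choice[f fP]]] := octahedral_norming (v := w) OX d0.
  move=> i; rewrite -normr_gt0; apply: le_lt_trans (w1 i).
  by rewrite mulr_ge0// subr_ge0 ltW.
exists (t x y); split=> [|i]; first exact: norm_elementary_tensor.
have [zs _ _ _] := sP i; have [gS _ gy] := gP i; have [fS fwi fx] := fP i.
have := injective_norm_ge ((x, y) :: s i) fS gS.
rewrite !big_cons /= -fw addrC [X in _ <= `|X|]addrC.
move=> /(le_trans (ler_norm _)) us.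
(* Passing from the approximating tensor back to [z i] costs at most [d]. *)
have := ler_distD (z i + t x y) (\sum_(p <- s i) t p.1 p.2 + t x y) 0.
rewrite !subr0 opprD addrACA subrr addr0 => tri; rewrite distrC in zs.
have fxgy : (1 - d) * (1 - d) < f i x * g i y.
  by apply: ltr_pM => //; rewrite subr_ge0 ltW.
have fwi' : (1 - d) * ((1 - d) * (1 - d)) < f i (w i).
  by apply: lt_trans fwi; rewrite ltr_pM2l// subr_gt0.
nra.
Qed.

End InjectiveTensor.

Theorem corollary2p4 (R : realType) (X Y : completeNormedModType R)
    (X_nonzero : exists x : X, x != 0) (Y_nonzero : exists y : Y, y != 0)
    (Z : completeNormedModType R) (t : {bilinear X -> Y -> Z})
    (Z_tensor : is_injective_tensor_product t) :
  (octahedral X -> octahedral Y -> octahedral Z) /\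
  (octahedral X -> (exists y : Y, `|y| = 1 /\ numerical_index y = 1) ->
   octahedral Z).
Proof.
split=> [OX OY|OX [y [y1 ny]]]; apply: (octahedral_tensor Z_tensor OX) => n v d.
  move=> d0 _ v0; have [y [y1 yP]] := octahedral_norming OY d0 v0.
  exists y; split=> // i; have [g [gS gv gy]] := yP i.
  by exists g; split=> //; apply: lt_le_trans gv (ler_norm _).
move=> d0 d1 v0; exists y; split=> // i.
have [g [gS gv gy]] := numerical_index_norming y1 ny d0 d1 (v0 i).
by exists g; split=> //; rewrite gy; lra.
Qed.
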